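(* Let $(F,\iota,\mu)$ be a (not necessarily associative) monad on the category $\mathrm{Set}$ of sets. Then $F$ weakly preserves products if and only if $F(\boldsymbol{1})\cong\boldsymbol{1}$.
   Context: $\boldsymbol{1}=\{0\}$ denotes a one-element set. A (not necessarily associative) $\mathrm{Set}$-monad is a functor $F:\mathrm{Set}\to\mathrm{Set}$ together with natural transformations $\iota:\mathrm{Id}\to F$ and $\mu:F\circ F\to F$ satisfying the two unit laws $\mu_X\circ\iota_{F(X)}=\mathrm{id}_{F(X)}=\mu_X\circ F\iota_X$ for every set $X$; the associative law is not required. Products are binary products. A weak product of $A_1,A_2$ is an object $W$ with morphisms $w_i:W\to A_i$ ($i=1,2$) such that for every object $Q$ with morphisms $q_i:Q\to A_i$ there exists a (not necessarily unique) morphism $d:Q\to W$ with $q_i=w_i\circ d$ for $i=1,2$. The functor $F$ weakly preserves products if whenever $(P,p_1,p_2)$ is a product of $A_1,A_2$, then $(F(P),Fp_1,Fp_2)$ is a weak product of $F(A_1),F(A_2)$. (Equivalently, for all sets $A_1,A_2$ with projections $\pi_i:A_1\times A_2\to A_i$, the canonical map $(F\pi_1,F\pi_2):F(A_1\times A_2)\to F(A_1)\times F(A_2)$ is surjective.) *)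

(* Defs.v *)
From mathcomp Require Import ssreflect ssrfun.

Set Implicit Arguments.
Unset Strict Implicit.
Unset Printing Implicit Defensive.

(* Objects of the category Set.  Being monomorphic, this constant fixes one
   universe, so that a functor [sets -> sets] is a genuine endofunctor which
   can be composed with itself.  Morphisms are Rocq functions, compared by
   Leibniz equality. *)
Definition sets := Type.

Record set_functor := SetFunctor {
  fobj :> sets -> sets;
  fmap : forall X Y : sets, (X -> Y) -> fobj X -> fobj Y;
  fmap_id : forall X : sets, fmap (@id X) = @id (fobj X);
  fmap_comp : forall (X Y Z : sets) (g : Y -> Z) (f : X -> Y),
    fmap (g \o f) = fmap g \o fmap f
}.

Arguments fmap F {X Y} f : rename.

Definition id_functor : set_functor :=
  @SetFunctor (fun X => X) (fun X Y f => f)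
    (fun X => erefl) (fun X Y Z g f => erefl).

Lemma comp_fmap_id (G F : set_functor) (X : sets) :
  fmap G (fmap F (@id X)) = @id (G (F X)).
Proof. by rewrite (fmap_id F) (fmap_id G). Qed.

Lemma comp_fmap_comp (G F : set_functor) (X Y Z : sets)
    (g : Y -> Z) (f : X -> Y) :
  fmap G (fmap F (g \o f)) = fmap G (fmap F g) \o fmap G (fmap F f).
Proof. by rewrite (fmap_comp F) (fmap_comp G). Qed.

Definition comp_functor (G F : set_functor) : set_functor :=
  @SetFunctor (fun X => G (F X)) (fun X Y f => fmap G (fmap F f))
    (comp_fmap_id G F) (comp_fmap_comp G F).

Record nat_trans (F G : set_functor) := NatTrans {
  component :> forall X : sets, F X -> G X;
  naturality : forall (X Y : sets) (f : X -> Y),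
    @component Y \o fmap F f = fmap G f \o @component X
}.

Arguments component {F G} _ X _ : rename.

(* Associativity of [mu] is deliberately not required. *)
Record na_monad := NaMonad {
  monad_functor :> set_functor;
  iota_ : nat_trans id_functor monad_functor;
  mu_ : nat_trans (comp_functor monad_functor monad_functor) monad_functor;
  mu_iota : forall X : sets,
    mu_ X \o iota_ (monad_functor X) = @id (monad_functor X);
  mu_fmap_iota : forall X : sets,
    mu_ X \o fmap monad_functor (iota_ X) = @id (monad_functor X)
}.

Definition is_product (A1 A2 P : sets) (p1 : P -> A1) (p2 : P -> A2) : Prop :=
  forall (Q : sets) (q1 : Q -> A1) (q2 : Q -> A2),
    exists! d : Q -> P, q1 = p1 \o d /\ q2 = p2 \o d.

Definition is_weak_product (A1 A2 W : sets) (w1 : W -> A1) (w2 : W -> A2)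
    : Prop :=
  forall (Q : sets) (q1 : Q -> A1) (q2 : Q -> A2),
    exists d : Q -> W, q1 = w1 \o d /\ q2 = w2 \o d.

Definition weakly_preserves_products (F : set_functor) : Prop :=
  forall (A1 A2 P : sets) (p1 : P -> A1) (p2 : P -> A2),
    is_product p1 p2 -> is_weak_product (fmap F p1) (fmap F p2).

Definition isomorphic (X Y : sets) : Prop := exists f : X -> Y, bijective f.

(* Main.v *)
(* If [F unit] is a singleton, then [F] sends the constant map with value [x]
   to the constant map with value [iota x].  Hence, for [s : F A] and
   [t : F B], the element [mu (F (a |-> F (b |-> (a, b)) t) s)] of [F (A * B)]
   projects to [mu (F iota s) = s] on [F A] and to [mu (iota t) = t] on [F B]:
   each unit law is used once, and associativity never.  Conversely, [unit] is
   a product of [unit] with itself with equal projections, and weak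
   preservation of this product makes any two elements of [F unit] equal. *)
Require Import Defs.
From mathcomp Require Import ssreflect ssrfun.
From Stdlib Require Import FunctionalExtensionality.

Lemma fmap_compE (F : set_functor) (X Y Z : sets) (g : Y -> Z) (f : X -> Y)
    (s : F X) : fmap F g (fmap F f s) = fmap F (g \o f) s.
Proof. by rewrite fmap_comp. Qed.

Lemma naturalityE (F G : set_functor) (n : nat_trans F G) (X Y : sets)
    (f : X -> Y) (s : F X) : n Y (fmap F f s) = fmap G f (n X s).
Proof. exact: (congr1 (fun h => h s) (naturality n f)). Qed.

Lemma mu_iotaE (F : na_monad) (X : sets) (s : F X) :
  mu_ F X (iota_ F (F X) s) = s.
Proof. exact: (congr1 (fun h => h s) (mu_iota F X)). Qed.

Lemma mu_fmap_iotaE (F : na_monad) (X : sets) (s : F X) :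
  mu_ F X (fmap F (iota_ F X) s) = s.
Proof. exact: (congr1 (fun h => h s) (mu_fmap_iota F X)). Qed.

Lemma is_product_unit : @is_product unit unit unit id id.
Proof.
move=> Q q1 q2; exists (fun=> tt); split.
  by split; apply: functional_extensionality => x /=; case: (_ x).
by move=> d _; apply: functional_extensionality => x; case: (d x).
Qed.

Lemma weakly_preserves_products_fmap_unit (F : set_functor) :
  weakly_preserves_products F -> forall s t : F unit, s = t.
Proof.
move=> wF s t.
have [d [ds dt]] := wF _ _ _ _ _ is_product_unit unit (fun=> s) (fun=> t).
exact: (congr1 (fun h => h tt) (etrans ds (esym dt))).
Qed.

Definition mpair (F : na_monad) (A B : sets) (s : F A) (t : F B) : F (A * B)%type :=
  mu_ F _ (fmap F (fun a => fmap F (fun b => (a, b)) t) s).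

Section UnitPreserving.
Variable F : na_monad.
Hypothesis F1 : forall s t : F unit, s = t.

(** The constant map factors through [unit]; in [F unit] the image of [s] equals [iota tt], and
    naturality of [iota] carries this to [Y]. *)
Lemma fmap_const (X Y : sets) (y : Y) (s : F X) :
  fmap F (fun=> y) s = iota_ F Y y.
Proof.
rewrite -[LHS](fmap_compE F X unit Y (fun=> y) (fun=> tt)).
rewrite (F1 (fmap F _ s) (iota_ F unit tt)).
exact: esym (naturalityE _ _ (iota_ F) unit Y (fun=> y) tt).
Qed.

Lemma fmap_fst_mpair (A B : sets) (s : F A) (t : F B) :
  fmap F fst (mpair F A B s t) = s.
Proof.
rewrite /mpair -naturalityE /= fmap_compE -[RHS]mu_fmap_iotaE.
congr (mu_ F _ (fmap F _ s)); apply: functional_extensionality => a /=.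
by rewrite fmap_compE fmap_const.
Qed.

Lemma fmap_snd_mpair (A B : sets) (s : F A) (t : F B) :
  fmap F snd (mpair F A B s t) = t.
Proof.
rewrite /mpair -naturalityE /= fmap_compE -[RHS]mu_iotaE.
(* Read backwards, this turns [iota t] into an image of [s], so that both sides map over [s]. *)
rewrite -(fmap_const A (F B) t s).
congr (mu_ F _ (fmap F _ s)); apply: functional_extensionality => a /=.
by rewrite fmap_compE (fmap_id F).
Qed.

Lemma fmap_unit_weakly_preserves_products : weakly_preserves_products F.
Proof.
move=> A1 A2 P p1 p2 prodP Q q1 q2.
(* [P] is any product; its universal property gives [h], which transports [mpair] from [A1 * A2] to
   [P]. *)
have [h [[fstE sndE] _]] := prodP (A1 * A2)%type fst snd.
exists (fun x => fmap F h (mpair F A1 A2 (q1 x) (q2 x))).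
split; apply: functional_extensionality => x /=; rewrite fmap_compE.
  by rewrite -fstE fmap_fst_mpair.
by rewrite -sndE fmap_snd_mpair.
Qed.

End UnitPreserving.

Theorem theorem1 (F : na_monad) :
  weakly_preserves_products F <-> isomorphic (F unit) unit.
Proof.
split=> [wF | [f /bij_inj f_inj]].
  exists (fun=> tt); exists (fun=> iota_ F unit tt) => [s | []] //.
  exact: weakly_preserves_products_fmap_unit.
apply: fmap_unit_weakly_preserves_products => s t.
by apply: f_inj; case: (f s); case: (f t).
Qed.
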